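(* Let $X\sim\mathrm{CO}(\mu;q)$ with $q(j)=\delta j^2+\beta j+\gamma$ and pmf $p$, let $S=\{\alpha,\ldots,\omega\}$ be its support and $M=|S|-1$. Suppose $\mathbb E|X|^{2n}<\infty$ for some integer $1\le n\le M$. Then, for $k=1,2,\ldots,n$, $$\Delta\phi_k(j)=v_{k-1}\,\phi^*_{k-1}(j),\qquad v_{k-1}=\left\{\frac{k[1-(k-1)\delta]}{\mathbb E[q(X)]}\right\}^{1/2},$$ for all $j\in\{\alpha,\ldots,\omega-1\}$ (equivalently, as an identity of polynomials), where $\phi_k$ are the standardized Rodrigues polynomials of $X$ and $\phi_k^*$ are the standardized Rodrigues polynomials of the random variable $X^*$ with pmf $p^*\propto qp$.
   Context: An integer-valued random variable $X$ with finite mean $\mu$ and pmf $p$ satisfies $X\sim\mathrm{CO}(\mu;q)$ (Cumulative Ord family), with $q(j)=\delta j^2+\beta j+\gamma$ a real polynomial of degree at most two, if $\sum_{k\le j}(\mu-k)p(k)=q(j)p(j)$ for all $j\in\mathbb Z$. Its support $S=\{j:p(j)>0\}$ is a set of consecutive integers $\{\alpha,\ldots,\omega\}$ ($\alpha,\omega$ possibly infinite). Notation: $\Delta f(j)=f(j+1)-f(j)$, $\Delta^k$ its iterates; $f^{[k]}(x)=f(x)\cdots f(x+k-1)$, $f^{[0]}=1$; $c_k(\delta)=\prod_{j=k-1}^{2k-2}(1-j\delta)$, $c_0(\delta)=1$. Rodrigues polynomials: for $j\in S$, $P_k(j)=\frac{(-1)^k}{p(j)}\Delta^k\big[q^{[k]}(j-k)p(j-k)\big]$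 (the difference being taken in $j$); it is the restriction to $S$ of a real polynomial of degree at most $k$ with coefficient of $x^k$ equal to $c_k(\delta)$. Standardized: $\phi_k(j)=\{k!\,c_k(\delta)\,\mathbb E[q^{[k]}(X)]\}^{-1/2}P_k(j)$, $k=0,\ldots,n$. For $X^*$ (pmf $p^*\propto qp$, support $\{\alpha,\ldots,\omega-1\}$) put $q^*(j)=q(j+1)/(1-2\delta)$, $\delta^*=\delta/(1-2\delta)$, $P_k^*(j)=\frac{(-1)^k}{p^*(j)}\Delta^k\big[(q^* )^{[k]}(j-k)p^*(j-k)\big]$ and $\phi_k^*(j)=\{k!\,c_k(\delta^* )\,\mathbb E[(q^* )^{[k]}(X^* )]\}^{-1/2}P_k^*(j)$; in particular $\phi_0^*\equiv1$. *)

(* Defs.v *)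
From HB Require Import structures.
From mathcomp Require Import all_boot all_order all_algebra.
From mathcomp Require Import all_classical all_reals all_analysis.
Set Implicit Arguments.
Unset Strict Implicit.
Unset Printing Implicit Defensive.
Import Order.TTheory GRing.Theory Num.Theory.
Import numFieldNormedType.Exports.
Local Open Scope classical_set_scope.
Local Open Scope ring_scope.

Definition Delta (R : zmodType) (f : int -> R) (j : int) : R := f (j + 1) - f j.

(* f^{[k]}(x) = f(x) f(x+1) ... f(x+k-1) *)
Definition ascending (R : pzRingType) (f : R -> R) (k : nat) (x : R) : R :=
  \prod_(i < k) f (x + i%:R).

Definition quadratic (R : pzRingType) (delta beta gamma x : R) : R :=
  delta * x ^+ 2 + beta * x + gamma.

(* c_k(delta): the product over k-1 <= j <= 2k-2; truncated subtraction makes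
   the range empty for k = 0, so c_0(delta) = 1. *)
Definition lead_c (R : pzRingType) (k : nat) (delta : R) : R :=
  \prod_(k.-1 <= j < (2 * k).-1) (1 - j%:R * delta).

Definition integer_valued (T : Type) (R : archiRealDomainType) (X : T -> R) :=
  forall t, X t \is a Num.int.

Definition pmfZ d (T : measurableType d) (R : realType) (P : probability T R)
  (X : {RV P >-> R}) (j : int) : R := pmf X j%:~R.

Definition supportZ d (T : measurableType d) (R : realType)
  (P : probability T R) (X : {RV P >-> R}) : set int := [set j | 0 < pmfZ X j].

(* X ~ CO(mu; q).  The sum over all integers k <= j is the series whose i-th
   term is the summand at k = j - i; it converges absolutely by integrability
   of X. *)
Definition CumulativeOrd d (T : measurableType d) (R : realType)
    (P : probability T R) (X : {RV P >-> R}) (mu : R) (q : R -> R) : Prop :=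
  [/\ integer_valued X,
      P.-integrable [set: T] (EFin \o X),
      ('E_P[X] = mu%:E)%E
    & forall j : int,
        series (fun i : nat => (mu - (j - i%:Z)%:~R) * pmfZ X (j - i%:Z)) @ \oo
          --> q j%:~R * pmfZ X j].

Definition Rodrigues (R : fieldType) (p : int -> R) (q : R -> R) (k : nat)
    (j : int) : R :=
  (-1) ^+ k / p j *
  iter k (@Delta R)
    (fun i => ascending q k (i - k%:Z)%:~R * p (i - k%:Z)) j.

(* The expectation of ascending q k is finite whenever X has a finite absolute
   moment of order 2k, so fine loses nothing there. *)
Definition std_Rodrigues d (T : measurableType d) (R : realType)
    (P : probability T R) (X : {RV P >-> R}) (q : R -> R) (delta : R) (k : nat)
    (j : int) : R :=
  (Num.sqrt (k`!%:R * lead_c k delta * fine 'E_P[ascending q k \o X]))^-1 *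
  Rodrigues (pmfZ X) q k j.

(* Division by zero: delta = 1/2 is compatible with a finite moment of order 2n
   and at least n + 1 support points only if n = 1.  Then q^* enters only through
   phi^*_0, which is 1 whatever the values of q^* and delta^*. *)
Definition q_star (R : fieldType) (delta : R) (q : R -> R) (x : R) : R :=
  q (x + 1) / (1 - 2 * delta).

Definition delta_star (R : fieldType) (delta : R) : R :=
  delta / (1 - 2 * delta).

Definition v_coef d (T : measurableType d) (R : realType)
    (P : probability T R) (X : {RV P >-> R}) (q : R -> R) (delta : R)
    (k : nat) : R :=
  Num.sqrt (k.+1%:R * (1 - k%:R * delta) / fine 'E_P[q \o X]).

(* Main.v *)
(** The forward difference intertwines the operators h |-> q h - s h(.-1),
    where s(x) = q(x) + x - mu, attached to the weights p and q p (for the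
    latter q becomes q(.+1) while s is unchanged), up to a multiple of h.  As
    the Rodrigues polynomials are obtained by iterating such operators on 1,
    the k-th one of X has as difference a multiple of the (k-1)-th one of Y = X^*.
    The normalizing constants match because E[g(Y)] E[q(X)] = E[g(X) q(X)].
    What remains is the sign 1 - 2(k-1) delta > 0: the function F = q^[k] p is
    nonnegative, nonzero, vanishes at both infinities by the moment
    assumption, and F(j) - F(j-1) is an affine function of j of slope
    -(1 - 2(k-1) delta) times a nonnegative function; were that slope
    nonnegative, F could not vanish at both ends. *)
Require Import Defs.
From HB Require Import structures.
From mathcomp Require Import all_boot all_order all_algebra.
From mathcomp Require Import all_classical all_reals all_analysis.
From mathcomp Require Import measurable_realfun ring lra zify.
Set Implicit Arguments.
Unset Strict Implicit.
Unset Printing Implicit Defensive.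
Import Order.TTheory GRing.Theory Num.Theory.
Import numFieldNormedType.Exports.
Local Open Scope classical_set_scope.
Local Open Scope ring_scope.

(** * Ascending products and iterated differences *)

Lemma ascendingS (R : pzRingType) (f : R -> R) (k : nat) (x : R) :
  ascending f k.+1 x = f x * ascending (fun y => f (y + 1)) k x.
Proof.
rewrite /ascending big_ord_recl addr0; congr (_ * _).
by apply: eq_bigr => i _ /=; rewrite /bump /= add1n -natr1 addrA.
Qed.

Lemma eq_ascending (R : pzRingType) (f g : R -> R) (k : nat) (x : R) :
  f =1 g -> ascending f k x = ascending g k x.
Proof. by move=> fg; apply: eq_bigr => i _; rewrite fg. Qed.

Lemma iter_Delta_shift (R : zmodType) (k : nat) (f : int -> R) (a j : int) :
  iter k (@Delta R) (fun i => f (i + a)) j = iter k (@Delta R) f (j + a).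
Proof.
elim: k j => //= k IH j.
by rewrite /Delta !IH addrAC.
Qed.

Lemma eq_iter_Delta (R : zmodType) (k : nat) (f g : int -> R) (j : int) :
  f =1 g -> iter k (@Delta R) f j = iter k (@Delta R) g j.
Proof. by move=> /funext ->. Qed.

Lemma iter_DeltaZ (R : pzRingType) (k : nat) (c : R) (f : int -> R) (j : int) :
  iter k (@Delta R) (fun i => c * f i) j = c * iter k (@Delta R) f j.
Proof. by elim: k j => //= k IH j; rewrite /Delta !IH mulrBr. Qed.

(** * Shifts of polynomials and the unstandardized Rodrigues polynomials *)

Definition pshift (R : nzRingType) (h : {poly R}) : {poly R} :=
  h \Po ('X + 1%:P).

Definition punshift (R : nzRingType) (h : {poly R}) : {poly R} :=
  h \Po ('X - 1%:P).

(* [rodrigues_poly s q k] is p^-1 times the k-th difference of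
   q^{[k]}(j-k) p(j-k) for any weight p with q(j) p(j) = s(j+1) p(j+1): the
   weight q p satisfies the same relation with q(.+1) and the same s. *)
Fixpoint rodrigues_poly (R : nzRingType) (s q : {poly R}) (k : nat) :
    {poly R} :=
  if k is k'.+1 then
    let h := rodrigues_poly s (pshift q) k' in q * h - s * punshift h
  else 1.

(** Peeling the first factor off q^{[k+1]} turns the weight p into q p and q into q(.+1), with the
    argument moved back by one. The outermost difference then compares q(j) p(j) with q(j-1) p(j-1)
    = s(j) p(j), and p(j) factors out. *)
Lemma iter_Delta_rodrigues (R : comNzRingType) (s q : {poly R})
    (p : int -> R) (k : nat) (j : int) :
  (forall i, q.[i%:~R] * p i = s.[(i + 1)%:~R] * p (i + 1)) ->
  iter k (@Delta R)
    (fun i => ascending (horner q) k (i - k%:Z)%:~R * p (i - k%:Z)) j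
  = p j * (rodrigues_poly s q k).[j%:~R].
Proof.
elim: k q p j => [|k IH] q p j pearson.
  by rewrite /= /ascending big_ord0 subr0 !hornerE ?mulr1.
pose q1 := pshift q; pose p1 i := q.[i%:~R] * p i.
have q1E x : q1.[x] = q.[x + 1] by rewrite horner_comp !hornerE.
have pearson1 i : q1.[i%:~R] * p1 i = s.[(i + 1)%:~R] * p1 (i + 1).
  by rewrite q1E /p1 pearson intrD mulrCA.
have IH1 := IH q1 p1 _ pearson1.
pose g i := ascending (horner q1) k (i - k%:Z)%:~R * p1 (i - k%:Z).
transitivity (iter k.+1 (@Delta R) (fun i => g (i + -1)) j).
  apply: eq_iter_Delta => i; rewrite ascendingS /g /p1.
  have -> : i + -1 - k%:Z = i - k.+1%:Z by lia.
  by rewrite (@eq_ascending _ _ (horner q1)) // mulrCA mulrA.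
rewrite iterS {1}/Delta !iter_Delta_shift !IH1 addrK /p1.
have := pearson (j - 1); rewrite subrK => ->.
rewrite /= !hornerE horner_comp !hornerE intrB; ring.
Qed.

Lemma pshiftE (R : comNzRingType) (h : {poly R}) (x : R) :
  (pshift h).[x] = h.[x + 1].
Proof. by rewrite horner_comp !hornerE. Qed.

Lemma pshiftB (R : comNzRingType) (g h : {poly R}) :
  pshift (g - h) = pshift g - pshift h.
Proof. exact: rmorphB. Qed.

Lemma pshiftM (R : comNzRingType) (g h : {poly R}) :
  pshift (g * h) = pshift g * pshift h.
Proof. exact: rmorphM. Qed.

Lemma pshiftC (R : comNzRingType) (c : R) : pshift c%:P = c%:P.
Proof. exact: comp_polyC. Qed.

Lemma punshiftB (R : comNzRingType) (g h : {poly R}) :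
  punshift (g - h) = punshift g - punshift h.
Proof. exact: rmorphB. Qed.

Lemma pshiftK (R : comNzRingType) (h : {poly R}) : punshift (pshift h) = h.
Proof.
rewrite /punshift /pshift -comp_polyA comp_polyD comp_polyX comp_polyC subrK.
exact: comp_polyXr.
Qed.

Lemma punshiftK (R : comNzRingType) (h : {poly R}) : pshift (punshift h) = h.
Proof.
rewrite /punshift /pshift -comp_polyA comp_polyB comp_polyX comp_polyC addrK.
exact: comp_polyXr.
Qed.

(** Substituting the monic X - 1 keeps size and leading coefficient, so the top terms cancel. *)
Lemma size_sub_punshift (R : idomainType) (h : {poly R}) (k : nat) :
  (size h <= k.+1)%N -> (size (h - punshift h)%R <= k)%N.
Proof.
move=> hk; have sX : size ('X - 1%:P : {poly R}) = 2%N by rewrite size_XsubC.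
have szh : size (punshift h) = size h by exact: size_comp_poly2.
apply/leq_sizeP => i ki; rewrite coefB.
case: (ltngtP i (size h).-1) => [ih|ih|->]; last first.
- have := lead_coef_comp h (q := 'X - 1%:P).
  rewrite sX lead_coefXsubC expr1n mulr1 => /(_ isT).
  by rewrite /lead_coef -/(punshift h) szh => ->; rewrite subrr.
- have hi : (size h <= i)%N by move: ih; case: (size h).
  by rewrite !nth_default ?subr0 ?szh.
- have := leq_ltn_trans ki ih; rewrite ltnNge => /negP[].
  by move: hk; case: (size h).
Qed.

Lemma size_pshift (R : idomainType) (h : {poly R}) : size (pshift h) = size h.
Proof.
by apply: size_comp_poly2; rewrite -[1%:P]opprK -polyCN size_XsubC.
Qed.

Lemma size_sub_pshift (R : idomainType) (h : {poly R}) (k : nat) :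
  (size h <= k.+1)%N -> (size (pshift h - h)%R <= k)%N.
Proof.
by move=> hk; rewrite -{2}(pshiftK h) size_sub_punshift // size_pshift.
Qed.

(** In q h - s h(.-1) = q (h - h(.-1)) + (q - s) h(.-1) both terms raise the degree of h by at most
    one: a difference loses a degree and q has degree at most 2, while q - s has degree at most 1.
    The bounds on q and q - s survive the passage to q(.+1). *)
Lemma size_rodrigues_poly (R : idomainType) (s q : {poly R}) (k : nat) :
  (size q <= 3)%N -> (size (q - s)%R <= 2)%N ->
  (size (rodrigues_poly s q k) <= k.+1)%N.
Proof.
elim: k q => [|k IH] q q3 qs2; first by rewrite size_poly1.
have qq2 : (size (pshift q - q)%R <= 2)%N by exact: size_sub_pshift.
have {}IH : (size (rodrigues_poly s (pshift q) k) <= k.+1)%N.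
  apply: IH; first by rewrite size_pshift.
  have -> : pshift q - s = (pshift q - q) + (q - s) by rewrite addrA subrK.
  by rewrite (leq_trans (size_polyD _ _)) // geq_max qq2.
have predP m n : (m <= n.+1)%N -> (m.-1 <= n)%N by case: m.
rewrite /=; move: (rodrigues_poly _ _ _) IH => h hk.
have -> : q * h - s * punshift h = q * (h - punshift h) + (q - s) * punshift h.
  by rewrite mulrBr mulrBl addrA subrK.
rewrite (leq_trans (size_polyD _ _)) // geq_max; apply/andP; split.
- rewrite (leq_trans (size_polyMleq _ _)) //; apply: predP.
  exact: (leq_add q3 (size_sub_punshift hk)).
- rewrite (leq_trans (size_polyMleq _ _)) //; apply: predP.
  have -> : size (punshift h) = size h by rewrite size_comp_poly2 // size_XsubC.
  exact: (leq_add qs2 hk).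
Qed.

(* Shape invariance of h |-> q h - s h(.-1): commuting it with the forward
   difference changes q into q(.+1), up to a multiple of h. *)
Lemma pshift_sub_pearson (R : comNzRingType) (s q h : {poly R}) :
  let T q h := q * h - s * punshift h in
  pshift (T q h) - T q h
  = T (pshift q) (pshift h - h) - (pshift (s - q) - (s - q)) * h.
Proof.
rewrite /= !pshiftB !pshiftM punshiftB pshiftK punshiftK; ring.
Qed.

(** Here a is the slope of s - q and 2 d the second difference of q. Replacing q by q(.+1) with s
    fixed turns a into a - 2 d, so the coefficients obey (k+1) ((a - 2 d) - k d) + a = (k+2) (a -
    (k+1) d). *)
Lemma pshift_sub_rodrigues_poly (R : comNzRingType) (s q : {poly R})
    (a d : R) (k : nat) :
  pshift (s - q) - (s - q) = a%:P ->
  pshift (pshift q - q) - (pshift q - q) = (2 * d)%:P ->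
  pshift (rodrigues_poly s q k.+1) - rodrigues_poly s q k.+1
  = (- (k.+1%:R * (a - k%:R * d))) *: rodrigues_poly s (pshift q) k.
Proof.
elim: k q a => [|k IH] q a sqa qd.
  rewrite [rodrigues_poly _ _ 1]/= pshift_sub_pearson sqa pshiftC subrr.
  rewrite /punshift !rmorph0 !mulr0 subrr sub0r mul1r mul0r subr0 mulr1.
  by rewrite -polyCN alg_polyC.
rewrite [rodrigues_poly _ _ k.+2]/= pshift_sub_pearson sqa.
rewrite (IH _ (a - 2 * d)) /=; last 2 first.
- rewrite polyCB -sqa -qd !pshiftB; ring.
- by rewrite -(pshiftC (2 * d)) -qd !pshiftB.
rewrite -!mul_polyC -[punshift (_%:P * _)]/(_ \Po _) rmorphM /= comp_polyC.
rewrite -/(punshift _) mulrCA (mulrCA s) -mulrBr -mulrBl -polyCB.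
congr (_%:P * _).
rewrite -natr1; ring.
Qed.

Lemma lead_cS (R : fieldType) (delta : R) (m : nat) :
  ((0 < m)%N -> 1 - 2 * delta != 0) ->
  lead_c m.+1 delta
  = (1 - m%:R * delta) * (1 - 2 * delta) ^+ m * lead_c m (delta_star delta).
Proof.
case: m => [_|m /(_ isT) d2].
  by rewrite /lead_c big_nat1 big_geq // !mulr1.
rewrite /lead_c [m.+2.-1]/= [m.+1.-1]/=.
have -> : (2 * m.+2).-1 = ((2 * m.+1).-1 + 2)%N by lia.
rewrite [in LHS]big_ltn; last by lia.
rewrite -mulrA; congr (_ * _).
have -> : m.+2 = (m + 2)%N by rewrite addn2.
rewrite big_addn addnK.
have -> : (1 - 2 * delta) ^+ m.+1
    = \prod_(m <= j < (2 * m.+1).-1) (1 - 2 * delta).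
  by rewrite prodr_const_nat; congr (_ ^+ _); lia.
rewrite -big_split /=; apply: eq_bigr => i _.
by rewrite /delta_star natrD; field.
Qed.

(** * Expectations of integer-valued variables as series over the integers *)

Definition int_enum (n : nat) : int := if odd n then Negz n./2 else Posz n./2.

Lemma int_enum_inj : injective int_enum.
Proof.
move=> m n; rewrite /int_enum; case: ifP => om; case: ifP => on // -[mn];
by rewrite -(odd_double_half m) -(odd_double_half n) om on mn.
Qed.

Lemma int_enum_surj (j : int) : exists n, int_enum n = j.
Proof.
case: j => n; [exists n.*2|exists n.*2.+1]; rewrite /int_enum /=.
  by rewrite odd_double doubleK.
by rewrite odd_double /= uphalf_double.
Qed.

Section integer_valued_expectation.
Context d (T : measurableType d) (R : realType) (P : probability T R).
Variable X : {RV P >-> R}.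
Hypothesis Xint : integer_valued X.

Lemma pmfZE (j : int) : P (X @^-1` [set j%:~R]) = (pmfZ X j)%:E.
Proof. by rewrite /pmfZ /pmf fineK // fin_num_measure. Qed.

Lemma pmfZ_ge0 (j : int) : 0 <= pmfZ X j.
Proof. exact: pmf_ge0. Qed.

Lemma integral_preimage_pmfZ (f : R -> R) (j : int) :
  (\int[P]_(t in X @^-1` [set j%:~R]) (f (X t))%:E = (f j%:~R * pmfZ X j)%:E)%E.
Proof.
under eq_integral => t /[!inE] /= -> do over.
by rewrite integral_cst // EFinM; congr (_ * _)%E; exact: pmfZE.
Qed.

Lemma bigcup_int_enum :
  \bigcup_i X @^-1` [set (int_enum i)%:~R] = [set: T].
Proof.
apply/seteqP; split => // t _; have /intrP[j Xj] := Xint t.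
by have [i ij] := int_enum_surj j; exists i; rewrite //= ij.
Qed.

Lemma integral_bigcup_pmfZ (f : R -> R) (e : nat -> int) :
  measurable_fun [set: R] f -> (forall x, 0 <= f x) -> injective e ->
  (\int[P]_(t in \bigcup_i X @^-1` [set (e i)%:~R]) (f (X t))%:E
   = \sum_(i <oo) (f (e i)%:~R * pmfZ X (e i))%:E)%E.
Proof.
move=> mf f0 einj.
rewrite ge0_integral_bigcup //=.
- by apply: eq_eseriesr => i _; rewrite integral_preimage_pmfZ.
- apply/measurable_EFinP/measurable_funTS.
  exact: measurableT_comp mf (measurable_funPT X).
- by move=> t _; rewrite lee_fin.
- apply/trivIsetP => i j _ _ ij; rewrite -subset0 => t /= -[-> /intr_inj].
  by move=> /einj /eqP; rewrite (negbTE ij).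
Qed.

(** The sign condition is on f p because f will be q^{[k]}, which may be negative off the support.
    Such points carry no mass, so f(X) = |f(X)| almost surely and the nonnegative case applies to
    |f|. *)
Lemma expectation_pmfZ (f : R -> R) :
  measurable_fun [set: R] f ->
  (forall j : int, 0 <= f j%:~R * pmfZ X j) ->
  ('E_P[f \o X]
   = \sum_(i <oo) (f (int_enum i)%:~R * pmfZ X (int_enum i))%:E)%E.
Proof.
move=> mf f0; pose g (x : R) : R := `|f x|.
have g0 x : 0 <= g x by exact: normr_ge0.
have mg : measurable_fun setT g by exact: measurableT_comp.
transitivity ('E_P[g \o X])%E; last first.
  rewrite expectation.unlock -bigcup_int_enum.
  rewrite (integral_bigcup_pmfZ mg g0 int_enum_inj).
  apply: eq_eseriesr => i _; congr (_%:E).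
  by rewrite -[RHS]ger0_norm // normrM [`|pmfZ _ _|]ger0_norm ?pmfZ_ge0.
rewrite expectation.unlock; apply: ae_eq_integral => //.
- apply/measurable_EFinP.
  exact: measurableT_comp mf (measurable_funPT X).
- apply/measurable_EFinP.
  exact: measurableT_comp mg (measurable_funPT X).
(* The exceptional set is the countable union of these null events, on which f(X) < 0. *)
pose N i := if f (int_enum i)%:~R < 0 then X @^-1` [set (int_enum i)%:~R]
            else set0.
apply: (@negligibleS _ _ _ _ (\bigcup_i N i)); last first.
  apply: negligible_bigcup => i; rewrite /N; case: ifPn => [fi|_].
    apply/negligibleP; first exact: measurable_funPTI.
    apply: (etrans (pmfZE _)); congr (_%:E); apply/eqP.
    rewrite eq_le pmfZ_ge0 andbT.
    by rewrite -(nmulr_rge0 _ fi).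
  exact: negligible_set0.
move=> t /= tN; have /intrP[j Xj] := Xint t.
have [i ij] := int_enum_surj j.
exists i => //; rewrite /N ij; case: ifPn => [_ /=|/negP fi]; first by [].
apply: tN => _; congr (_%:E); rewrite /g /= ger0_norm // leNgt Xj.
exact/negP.
Qed.

(** Along an injective sequence of integers the series of these terms is bounded by the expectation,
    so it converges and its terms tend to 0. *)
Lemma cvg_pmfZ (f : R -> R) (e : nat -> int) :
  measurable_fun [set: R] f -> (forall x, 0 <= f x) -> injective e ->
  ('E_P[f \o X] < +oo)%E ->
  (fun i => f (e i)%:~R * pmfZ X (e i)) @ \oo --> (0 : R).
Proof.
move=> mf f0 einj Efin; apply: cvg_series_cvg_0.
apply: nnseries_is_cvg => [i|]; first by rewrite mulr_ge0 ?pmfZ_ge0.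
rewrite -integral_bigcup_pmfZ //; apply: le_lt_trans Efin.
rewrite expectation.unlock; apply: ge0_subset_integral => //.
- by apply: bigcupT_measurable => k; exact: measurable_funPTI.
- apply/measurable_EFinP.
  exact: measurableT_comp mf (measurable_funPT X).
- by move=> t _; rewrite lee_fin.
Qed.

End integer_valued_expectation.

(** * Functions on the integers that tend to 0 at both ends *)

Definition vanishing (R : realType) (F : int -> R) :=
  forall j : int, (fun i : nat => F (j + i%:Z)) @ \oo --> (0 : R) /\
                  (fun i : nat => F (j - i%:Z)) @ \oo --> (0 : R).

Lemma vanishingN (R : realType) (F : int -> R) :
  vanishing F -> vanishing (fun j => - F j).
Proof.
by move=> F0 j; have [Fr Fl] := F0 j; rewrite -oppr0; split; exact: cvgN.
Qed.

Lemma le_iter_right (R : realType) (F : int -> R) (j : int) :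
  (forall i, j <= i -> F i <= F (i + 1)) -> forall i : nat, F j <= F (j + i%:Z).
Proof.
move=> Fle; elim=> [|i IH]; first by rewrite addr0.
apply: (le_trans IH); have -> : j + i.+1%:Z = j + i%:Z + 1 by lia.
by apply: Fle; lia.
Qed.

Lemma le_iter_left (R : realType) (F : int -> R) (j : int) :
  (forall i, i <= j -> F i <= F (i - 1)) -> forall i : nat, F j <= F (j - i%:Z).
Proof.
move=> Fle; elim=> [|i IH]; first by rewrite subr0.
apply: (le_trans IH); have -> : j - i.+1%:Z = j - i%:Z - 1 by lia.
by apply: Fle; lia.
Qed.

Lemma vanishing_le0_right (R : realType) (F : int -> R) (j : int) :
  vanishing F -> (forall i, j <= i -> F i <= F (i + 1)) -> F j <= 0.
Proof.
move=> /(_ j)[F0 _] /le_iter_right Fle; rewrite -(cvg_lim _ F0) //.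
by apply: limr_ge; [apply/cvg_ex; exists 0|exact: nearW].
Qed.

Lemma vanishing_le0_left (R : realType) (F : int -> R) (j : int) :
  vanishing F -> (forall i, i <= j -> F i <= F (i - 1)) -> F j <= 0.
Proof.
move=> /(_ j)[_ F0] /le_iter_left Fle; rewrite -(cvg_lim _ F0) //.
by apply: limr_ge; [apply/cvg_ex; exists 0|exact: nearW].
Qed.

(* If a <= 0 then F is monotone or valley-shaped, so it cannot vanish at both
   ends. *)
Lemma vanishing_slope_gt0 (R : realType) (F G : int -> R) (a b : R) (j0 : int) :
  vanishing F -> (forall j, 0 <= G j) ->
  (forall j, F j - F (j - 1) = (b - a * j%:~R) * G j) -> 0 < F j0 -> 0 < a.
Proof.
move=> F0 G0 dF Fj0; rewrite ltNge; apply/negP => a0.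
suff : F j0 <= 0 by rewrite leNgt Fj0.
(* As a <= 0, the affine factor is nondecreasing: its sign at j0 + 1 persists either to the right or
   to the left, and F then grows away from j0 in that direction towards its limit 0. *)
have [b0|b0] := leP 0 (b - a * (j0 + 1)%:~R).
  apply: vanishing_le0_right => // i ij; rewrite -subr_ge0.
  have := dF (i + 1); rewrite addrK => ->; apply: mulr_ge0 => //.
  have : (j0 + 1)%:~R <= (i + 1)%:~R :> R by rewrite ler_int; lia.
  move: b0 a0; set u := _%:~R; set w := _%:~R; nra.
apply: vanishing_le0_left => // i ij; rewrite -subr_le0 dF.
apply: mulr_le0_ge0 => //.
have : i%:~R <= (j0 + 1)%:~R :> R by rewrite ler_int; lia.
move: b0 a0; set u := _%:~R; set w := _%:~R; nra.
Qed.

(** * Signs of q p and of the weights q^{[k]} p *)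

Section pearson_weight.
Context (R : realType) (p : int -> R) (q : R -> R) (mu : R).
Hypothesis p_ge0 : forall j, 0 <= p j.
Let W (j : int) := q j%:~R * p j.
Hypothesis dW : forall j, W j - W (j - 1) = (mu - j%:~R) * p j.
Hypothesis W_vanishing : vanishing W.

(** By [dW] the function W rises up to mu and falls afterwards; with limit 0 at both ends it cannot
    be negative. *)
Lemma weight_ge0 (j : int) : 0 <= q j%:~R * p j.
Proof.
rewrite -oppr_le0 -/(W j); have NW0 := vanishingN W_vanishing.
have [jmu|jmu] := leP j%:~R mu.
  apply: (vanishing_le0_left NW0) => i ij; rewrite lerN2 -subr_ge0 dW.
  by rewrite mulr_ge0 // subr_ge0 (le_trans _ jmu) // ler_int.
apply: (vanishing_le0_right NW0) => i ij; rewrite lerN2 -subr_le0.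
have := dW (i + 1); rewrite addrK => ->; apply: mulr_le0_ge0 => //.
by rewrite subr_le0 (le_trans (ltW jmu)) // ler_int; lia.
Qed.

(** By unimodality W(j) >= W(l) >= (mu - l) p(l) > 0 if j < mu, and W(j) >= W(h-1) >= (h - mu) p(h)
    > 0 otherwise. *)
Lemma weight_gt0 (l j h : int) :
  0 < p l -> 0 < p h -> l <= j -> j < h -> 0 < q j%:~R * p j.
Proof.
move=> pl ph lj jh; rewrite -/(W j).
have [jmu|muj] := ltP j%:~R mu.
  have Wl : 0 < W l.
    have := dW l; move=> /(canRL (subrK _)) ->.
    rewrite ltr_pwDl ?weight_ge0 // mulr_gt0 // subr_gt0 (le_lt_trans _ jmu) //.
    by rewrite ler_int.
  apply: (lt_le_trans Wl); rewrite -lerN2.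
  have := @le_iter_left _ (fun i => - W i) j.
  move=> /(_ _ (absz (j - l)%R)).
  rewrite (_ : j - (absz (j - l)%R)%:Z = l); last by lia.
  apply => i ij; rewrite lerN2 -subr_ge0 dW.
  by rewrite mulr_ge0 // subr_ge0 ltW // (le_lt_trans _ jmu) // ler_int.
have Wh : 0 < W (h - 1).
  have -> : W (h - 1) = W h + (h%:~R - mu) * p h.
    by rewrite -[h%:~R - mu]opprB mulNr -dW opprB addrCA subrr addr0.
  rewrite ltr_wpDl ?weight_ge0 // mulr_gt0 // subr_gt0 (le_lt_trans muj) //.
  by rewrite ltr_int.
apply: (lt_le_trans Wh); rewrite -lerN2.
have := @le_iter_right _ (fun i => - W i) j.
move=> /(_ _ (absz (h - 1 - j)%R)).
rewrite (_ : j + (absz (h - 1 - j)%R)%:Z = h - 1); last by lia.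
apply => i ij; rewrite lerN2 -subr_le0; have := dW (i + 1); rewrite addrK => ->.
apply: mulr_le0_ge0 => //.
by rewrite subr_le0 (le_trans muj) // ler_int; lia.
Qed.

Lemma ascendingS_weight (k : nat) (j : int) :
  ascending q k.+1 j%:~R * p j = ascending q k (j + 1)%:~R * W j.
Proof.
rewrite ascendingS mulrAC mulrC /W; congr (_ * _); rewrite intrD.
by apply: eq_bigr => i _; rewrite addrAC.
Qed.

Lemma ascending_weight_ge0 (k : nat) (j : int) :
  0 <= ascending q k j%:~R * p j.
Proof.
elim: k j => [|k IH] j; first by rewrite /ascending big_ord0 mul1r.
rewrite ascendingS_weight.
(* If p(j+1) > 0, the induction hypothesis at j + 1 gives the sign of q^{[k]}(j+1). If p(j+1) = 0,
   then W(j+1) = 0 and [dW] forces W(j) = 0. *)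
have [pj|pj] := ltP 0 (p (j + 1)).
  by rewrite mulr_ge0 ?weight_ge0 // -(pmulr_lge0 _ pj).
have {}pj : p (j + 1) = 0 by apply/eqP; rewrite eq_le pj p_ge0.
have := dW (j + 1); rewrite addrK {1}/W pj !mulr0 sub0r => /eqP.
by rewrite oppr_eq0 => /eqP ->; rewrite mulr0.
Qed.

Lemma ascending_weight_gt0 (k : nat) (l h : int) :
  0 < p l -> 0 < p h -> l + k%:Z <= h -> 0 < ascending q k l%:~R * p l.
Proof.
move=> pl ph lkh; rewrite mulr_gt0 // /ascending.
apply: prodr_gt0 => i _; have := ltn_ord i => ik.
have W_gt0 : 0 < q (l + (i : nat)%:Z)%:~R * p (l + (i : nat)%:Z).
  by apply: (weight_gt0 pl ph); lia.
have p_gt0 : 0 < p (l + (i : nat)%:Z).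
  rewrite lt0r p_ge0 andbT; apply: contraTneq W_gt0 => ->.
  by rewrite mulr0 ltxx.
by move: W_gt0; rewrite (pmulr_lgt0 _ p_gt0) intrD.
Qed.

End pearson_weight.

(** * Measurability and growth of ascending products *)

Lemma ascendingSr (R : pzRingType) (f : R -> R) (k : nat) (x : R) :
  ascending f k.+1 x = ascending f k x * f (x + k%:R).
Proof. by rewrite /ascending big_ord_recr. Qed.

Lemma ascendingZ (R : comPzRingType) (c : R) (f : R -> R) (k : nat) (x : R) :
  ascending (fun y => c * f y) k x = c ^+ k * ascending f k x.
Proof. by rewrite /ascending big_split /= prodr_const card_ord. Qed.

Lemma measurable_ascending (R : realType) (q : {poly R}) (k : nat) :
  measurable_fun [set: R] (ascending (horner q) k).
Proof.
apply: measurable_prod => i _.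
rewrite (_ : (fun x => _) = horner (q \Po ('X + i%:R%:P))).
  by apply: continuous_measurable_fun; exact: continuous_horner.
by apply/funext => x; rewrite horner_comp !hornerE.
Qed.

Lemma quadratic_shift_bound (R : realFieldType) (delta beta gamma : R)
    (k : nat) :
  exists2 C : R, 0 <= C & forall x,
    `|quadratic delta beta gamma (x + k%:R)| <= C * (1 + x ^+ 2).
Proof.
set M := `|delta| + `|beta| + `|gamma|.
have M0 : 0 <= M by rewrite !addr_ge0.
exists (M * (2 + 2 * k%:R ^+ 2)) => [|x].
  by rewrite mulr_ge0 // addr_ge0 // mulr_ge0 // sqr_ge0.
rewrite -mulrA; set y := x + k%:R.
have quad_le : `|quadratic delta beta gamma y| <= M * (1 + y ^+ 2).
  rewrite /quadratic /M.
  have y2 : 0 <= y ^+ 2 by rewrite sqr_ge0.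
  have y1 : `|y| <= 1 + y ^+ 2.
    have [y1|/ltW y1] := leP `|y| 1; first by rewrite (le_trans y1) ?lerDl.
    rewrite -(real_normK (num_real y)) expr2.
    rewrite (le_trans _ (_ : `|y| * `|y| <= _)) //.
      by rewrite ler_peMr.
    by rewrite lerDr.
  apply: (le_trans (ler_normD _ _)); rewrite !mulrDl; apply: lerD.
    apply: (le_trans (ler_normD _ _)); apply: lerD.
      rewrite normrM ler_wpM2l //.
      by rewrite [X in X <= _]ger0_norm ?lerDr.
    by rewrite normrM ler_wpM2l.
  by rewrite ler_peMr // lerDl.
apply: (le_trans quad_le); rewrite ler_wpM2l // /y.
rewrite -subr_ge0.
have -> : (2 + 2 * k%:R ^+ 2) * (1 + x ^+ 2) - (1 + (x + k%:R) ^+ 2)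
    = 1 + (x - k%:R) ^+ 2 + 2 * (x * k%:R) ^+ 2 by ring.
by rewrite addr_ge0 ?addr_ge0 ?(sqr_ge0, mulr_ge0 (ler0n _ 2) (sqr_ge0 _)).
Qed.

Lemma ascending_quadratic_bound (R : realFieldType) (delta beta gamma : R)
    (k : nat) :
  exists2 C : R, 0 <= C & forall x,
    `|ascending (quadratic delta beta gamma) k x| <= C * (1 + x ^+ 2) ^+ k.
Proof.
elim: k => [|k [C C0 IH]].
  by exists 1 => // x; rewrite /ascending big_ord0 normr1 mulr1.
have [C' C'0 qC'] := quadratic_shift_bound delta beta gamma k.
exists (C * C') => [|x]; first exact: mulr_ge0.
rewrite ascendingSr normrM exprSr mulrACA.
by apply: ler_pM.
Qed.

Lemma expr_1D_le (R : realFieldType) (y : R) (n : nat) :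
  0 <= y -> (1 + y) ^+ n <= 2 ^+ n * (1 + y ^+ n).
Proof.
move=> y0; have yn0 : 0 <= y ^+ n by rewrite exprn_ge0.
have [y1|/ltW y1] := leP y 1.
  apply: (@le_trans _ _ (2 ^+ n)); last by rewrite ler_peMr ?exprn_ge0 // lerDl.
  by apply: lerXn2r; rewrite ?nnegrE; lra.
apply: (@le_trans _ _ (2 ^+ n * y ^+ n)).
  by rewrite -exprMn; apply: lerXn2r; rewrite ?nnegrE; lra.
by rewrite ler_wpM2l ?exprn_ge0 // lerDr.
Qed.

(** * Scaling of [fine], spread of a set of integers, scaling of square roots *)

Lemma fineZ (R : realType) (a : R) (x : \bar R) :
  fine (a%:E * x)%E = a * fine x.
Proof.
rewrite muleC; case: x => [x||].
- by rewrite -EFinM mulrC.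
(* [fine] sends both infinities to 0, so both sides vanish. *)
- have [a0|a0|->] := ltgtP a 0; last by rewrite mule0 mul0r.
    by rewrite lt0_mulye ?lte_fin // mulr0.
  by rewrite gt0_mulye ?lte_fin // mulr0.
- have [a0|a0|->] := ltgtP a 0; last by rewrite mule0 mul0r.
    by rewrite lt0_mulNye ?lte_fin // mulr0.
  by rewrite gt0_mulNye ?lte_fin // mulr0.
Qed.

(** By pigeonhole: n + 1 distinct integers of spread less than n would all lie among the n integers
    starting at their minimum. *)
Lemma card_le_int_endpoints (n : nat) (S : set int) :
  (`I_n.+1 #<= S)%card -> exists l h : int, [/\ S l, S h & l + n%:Z <= h].
Proof.
move=> /card_leP[g].
have /injfunPex[f fS finj] : $|{injfun `I_n.+1 >-> S}| by squash (valLR 0 g).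
have fSi i : (i <= n)%N -> S (f i) by move=> ?; exact: fS.
have finj' : {in iota 0 n.+1 &, injective f}.
  move=> i j; rewrite !mem_iota !add0n /= => i1 j1 /finj; apply; rewrite inE //.
apply: contrapT => noLH.
have lt_n i j : (i <= n)%N -> (j <= n)%N -> f j < f i + n%:Z.
  move=> ii jj; rewrite ltNge; apply/negP => le_ij; apply: noLH.
  by exists (f i), (f j); split; [exact: fSi|exact: fSi|].
have n0 : (0 < n)%N by have := lt_n 0 0 isT isT; lia.
have [i0 i0n min_i0] : exists2 i0, (i0 <= n)%N &
    forall i, (i <= n)%N -> f i0 <= f i.
  pose i0 := [arg min_(i < (ord0 : 'I_n.+1)) f (i : nat)]%O.
  exists i0; first by rewrite -ltnS.
  move=> i ii; rewrite /i0; case: Order.TotalTheory.arg_minP => // k _.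
  exact: (fun H => H (Ordinal (ii : (i < n.+1)%N)) isT).
pose s := [seq f i0 + (k : nat)%:Z | k <- iota 0 n].
have : (size [seq f i | i <- iota 0 n.+1] <= size s)%N.
  apply: uniq_leq_size; first by rewrite map_inj_in_uniq // iota_uniq.
  move=> x /mapP[i]; rewrite mem_iota add0n ltnS /= => ii ->.
  apply/mapP; exists (absz (f i - f i0)%R).
    by rewrite mem_iota; have := lt_n _ _ i0n ii; have := min_i0 _ ii; lia.
  by have := min_i0 _ ii; lia.
by rewrite !size_map !size_iota ltnn.
Qed.

(** Rests on A = sqrt(A/E) sqrt(A E). It serves with E = E[q(X)], sqrt(A/E) = v_{k-1}, u = (1 - 2
    delta)^{k-1} and Z the radicand of phi^*_{k-1}. *)
Lemma sqrt_scaling (R : rcfType) (A E u Z : R) : 0 < A -> 0 < E -> 0 < u ->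
  (Num.sqrt (A * E * u ^+ 2 * Z))^-1 * A
  = Num.sqrt (A / E) * ((Num.sqrt Z)^-1 * u^-1).
Proof.
move=> A0 E0 u0.
have AE0 : 0 < A * E by exact: mulr_gt0.
rewrite sqrtrM; last by rewrite mulr_ge0 ?sqr_ge0 // ltW.
rewrite sqrtrM ?ltW // sqrtr_sqr gtr0_norm //.
have sA : A = Num.sqrt (A / E) * Num.sqrt (A * E).
  rewrite -sqrtrM ?divr_ge0 ?ltW // mulrACA mulVf ?gt_eqF //.
  by rewrite mulr1 -expr2 sqrtr_sqr gtr0_norm.
have sAE : Num.sqrt (A * E) != 0 by rewrite sqrtr_eq0 -ltNge.
rewrite [X in _ * X = _]sA !invfM.
move: (Num.sqrt Z)^-1 (u^-1) (Num.sqrt (A / E)) (Num.sqrt (A * E)) sAE.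
by move=> z w a b b0; field.
Qed.

(** * Consequences of the Cumulative Ord relation and of the moment condition *)

Section cumulative_ord.
Context d (T : measurableType d) (R : realType) (P : probability T R).
Context (X : {RV P >-> R}).

(** The series at j is the one at j - 1 preceded by the single term (mu - j) p(j). *)
Lemma CumulativeOrd_difference (mu : R) (q : R -> R) (j : int) :
  CumulativeOrd X mu q ->
  q j%:~R * pmfZ X j - q (j - 1)%:~R * pmfZ X (j - 1)
  = (mu - j%:~R) * pmfZ X j.
Proof.
case=> _ _ _ CO; have COj := CO j; have COj1 := CO (j - 1).
apply/eqP; rewrite subr_eq; apply/eqP.
rewrite -(cvg_lim _ COj) // -(cvg_lim _ COj1) //.
apply/cvg_lim => //; rewrite -(cvg_shiftn 1) /=.
rewrite (_ : (fun n => _) = (fun n => (mu - j%:~R) * pmfZ X j +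
   series (fun i : nat => (mu - (j - 1 - i%:Z)%:~R) * pmfZ X (j - 1 - i%:Z)) n)).
  by apply: cvgD; [exact: cvg_cst|rewrite (cvg_lim _ COj1)].
apply/funext => n; rewrite addn1 /series /= big_nat_recl //= subr0.
congr (_ + _).
apply: eq_bigr => i _; have -> // : j - i.+1%:Z = j - 1 - i%:Z by lia.
Qed.

Lemma vanishing_moment (n : nat) :
  ('E_P[(fun t => `|X t| ^+ n)%R] < +oo)%E ->
  vanishing (fun j => `|j%:~R| ^+ n * pmfZ X j).
Proof.
move=> EX j.
have mf : measurable_fun [set: R] (fun x : R => `|x| ^+ n).
  by apply: measurable_funX; exact: normr_measurable.
have f0 (x : R) : 0 <= `|x| ^+ n by rewrite exprn_ge0.
have injr : injective (fun i : nat => j + i%:Z) by move=> i k /addrI [].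
have injl : injective (fun i : nat => j - i%:Z).
  by move=> i k /addrI /oppr_inj [].
by split; [exact: (cvg_pmfZ mf f0 injr EX)|
           exact: (cvg_pmfZ mf f0 injl EX)].
Qed.

(** A product of k values of a quadratic is at most a constant times 1 + |j|^{2n}, and both p(j) and
    |j|^{2n} p(j) vanish at both ends. *)
Lemma vanishing_ascending (delta beta gamma : R) (n k : nat) :
  ('E_P[(fun t => `|X t| ^+ (2 * n))%R] < +oo)%E ->
  (k <= n)%N ->
  vanishing (fun j => ascending (quadratic delta beta gamma) k j%:~R
                      * pmfZ X j).
Proof.
move=> EX kn.
have [C C0 asc_le] := ascending_quadratic_bound delta beta gamma k.
pose D := C * 2 ^+ n.
pose H j := D * (`|j%:~R| ^+ 0 * pmfZ X j + `|j%:~R| ^+ (2 * n) * pmfZ X j).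
have H0 : vanishing H.
  have E0 : ('E_P[(fun t => `|X t| ^+ 0)%R] < +oo)%E.
    by rewrite (_ : (fun _ => _) = cst 1) // expectation_cst ltry.
  have V0 := vanishing_moment E0.
  have Vn := vanishing_moment EX.
  move=> j; have [V0r V0l] := V0 j; have [Vnr Vnl] := Vn j.
  have cvgH (u v : nat -> R) : u @ \oo --> (0 : R) -> v @ \oo --> (0 : R) ->
      (fun i => D * (u i + v i)) @ \oo --> (0 : R).
    move=> u0 v0; rewrite -[X in _ --> X](mulr0 D); apply: cvgM.
      exact: cvg_cst.
    by rewrite -[X in _ --> X](addr0 0); exact: cvgD.
  by split; exact: cvgH.
have le_H j : `|ascending (quadratic delta beta gamma) k j%:~R * pmfZ X j| <= H j.
  rewrite normrM (ger0_norm (pmfZ_ge0 _ _)) /H -mulrDl mulrA.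
  rewrite ler_wpM2r ?pmfZ_ge0 // (le_trans (asc_le _)) // /D -mulrA ler_wpM2l //.
  rewrite expr0 exprM real_normK ?num_real //.
  apply: (le_trans _ (expr_1D_le _ (sqr_ge0 _))).
  by rewrite ler_weXn2l // lerDl sqr_ge0.
move=> j; have [Hr Hl] := H0 j.
split; apply/norm_cvg0P.
  apply: (squeeze_cvgr _ (cvg_cst 0) Hr).
  by apply: nearW => i; rewrite normr_ge0 /=; exact: le_H.
apply: (squeeze_cvgr _ (cvg_cst 0) Hl).
by apply: nearW => i; rewrite normr_ge0 /=; exact: le_H.
Qed.

End cumulative_ord.

(** * The quadratic q as a polynomial *)

Definition quadratic_poly (R : nzRingType) (delta beta gamma : R) : {poly R} :=
  delta *: 'X^2 + beta *: 'X + gamma%:P.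

Lemma horner_quadratic_poly (R : comNzRingType) (delta beta gamma : R) :
  horner (quadratic_poly delta beta gamma) = quadratic delta beta gamma.
Proof. by apply/funext => x; rewrite /quadratic !hornerE. Qed.

Lemma size_quadratic_poly (R : nzRingType) (delta beta gamma : R) :
  (size (quadratic_poly delta beta gamma) <= 3)%N.
Proof.
rewrite (leq_trans (size_polyD _ _)) // geq_max.
rewrite (leq_trans (size_polyD _ _)) ?geq_max /=; last first.
  by rewrite !(leq_trans (size_scale_leq _ _)) ?size_polyXn ?size_polyX.
by rewrite (leq_trans (size_polyC_leq1 _)).
Qed.

Lemma second_difference_quadratic_poly (R : comNzRingType)
    (delta beta gamma : R) :
  let q := quadratic_poly delta beta gamma in
  pshift (pshift q - q) - (pshift q - q) = (2 * delta)%:P.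
Proof.
rewrite /= /quadratic_poly pshiftB /pshift -!mul_polyC.
rewrite expr2 !(comp_polyD, comp_polyM, comp_polyC, comp_polyX).
rewrite polyCM; ring.
Qed.

Lemma ascending_q_star (R : fieldType) (delta : R) (q : {poly R}) (k : nat)
    (x : R) :
  ascending (q_star delta (horner q)) k x
  = ((1 - 2 * delta) ^+ k)^-1 * ascending (horner (pshift q)) k x.
Proof.
rewrite -exprVn -ascendingZ; apply: eq_ascending => y.
by rewrite /q_star pshiftE mulrC.
Qed.

(** * The difference formula for the standardized polynomials *)

Theorem lemma7p5 (R : realType)
    (d : measure_display) (T : measurableType d) (P : probability T R)
    (X : {RV P >-> R}) (mu delta beta gamma : R)
    (X_CO : CumulativeOrd X mu (quadratic delta beta gamma))
    (n : nat) (n_ge1 : (1 <= n)%N)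
    (n_le_M : (`I_n.+1 #<= supportZ X)%card)
    (X_moment : ('E_P[(fun t => `|X t| ^+ (2 * n))%R] < +oo)%E)
    (d' : measure_display) (T' : measurableType d') (P' : probability T' R)
    (Xs : {RV P' >-> R})
    (Xs_int : integer_valued Xs)
    (Xs_pmf : exists c : R, forall j : int,
        pmfZ Xs j = c * (quadratic delta beta gamma j%:~R * pmfZ X j))
    (k : nat) (k_ge1 : (1 <= k)%N) (k_le_n : (k <= n)%N) :
  let q := quadratic delta beta gamma in
  let phi := std_Rodrigues X q delta k in
  let phis := std_Rodrigues Xs (q_star delta q) (delta_star delta) k.-1 in
  let v := v_coef X q delta k.-1 in
  (forall j : int, supportZ X j -> supportZ X (j + 1) ->
     Delta phi j = v * phis j) /\
  (exists F G : {poly R},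
     [/\ (size F <= k.+1)%N /\ (forall j, supportZ X j -> F.[j%:~R] = phi j),
         (size G <= k)%N /\ (forall j, supportZ Xs j -> G.[j%:~R] = phis j)
       & F \Po ('X + 1%:P) - F = v *: G]).
Proof.
case: k k_ge1 k_le_n => // m _ m_lt_n /=.
rewrite -horner_quadratic_poly in X_CO Xs_pmf *.
set q := quadratic_poly delta beta gamma in X_CO Xs_pmf *.
have [c Xs_pmfE] := Xs_pmf; have [X_int _ _ _] := X_CO.
(* With this s the differenced Cumulative Ord relation reads q(j) p(j) = s(j+1) p(j+1). *)
pose p := pmfZ X; pose s := q + ('X - mu%:P).
have p_ge0 j : 0 <= p j by exact: pmfZ_ge0.
have dW j := CumulativeOrd_difference j X_CO.
have W_vanishing : vanishing (fun j => q.[j%:~R] * p j).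
  have := vanishing_ascending delta beta gamma X_moment n_ge1.
  rewrite -horner_quadratic_poly -/q.
  under eq_fun do rewrite /ascending big_ord1 addr0.
  by [].
have asc_ge0 := ascending_weight_ge0 p_ge0 dW W_vanishing.
have [l [h [pl ph lh]]] := card_le_int_endpoints n_le_M.
have asc_gt0 : 0 < ascending (horner q) m.+1 l%:~R * p l.
  by apply: (ascending_weight_gt0 p_ge0 dW W_vanishing pl ph); lia.
have slope_gt0 : 0 < 1 - 2 * m%:R * delta.
  have := vanishing_ascending delta beta gamma X_moment m_lt_n.
  rewrite -horner_quadratic_poly -/q => asc_vanishing.
  (* The increment of q^{[m+1]} p at j is q^{[m]}(j) p(j) times q(j+m) - q(j) + mu - j, which equals
     b - (1 - 2 m delta) j. *)
  pose b := mu + delta * m%:R ^+ 2 + beta * m%:R.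
  apply: (vanishing_slope_gt0 (b := b) asc_vanishing (asc_ge0 m) _ asc_gt0) => j.
  have := ascendingS_weight p (horner q) m (j - 1); rewrite subrK => ->.
  rewrite ascendingSr.
  have -> : q.[(j - 1)%:~R] * p (j - 1) = q.[j%:~R] * p j - (mu - j%:~R) * p j.
    by rewrite -dW subKr.
  rewrite /p horner_quadratic_poly /quadratic /b; ring.
(* The sign follows from [slope_gt0] only for m > 0; delta = 1/2 is not excluded at m = 0, where u
   below is 1. *)
have d2_gt0 : (0 < m)%N -> 0 < 1 - 2 * delta.
  move=> m0; have m1 : 1 <= m%:R :> R by rewrite ler1n.
  have [d0|d0] := leP delta 0; first lra.
  move: slope_gt0; nra.
have m_gt0 : 0 < 1 - m%:R * delta.
  have m0 : 0 <= m%:R :> R by rewrite ler0n.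
  have [d0|d0] := leP delta 0; first nra.
  move: slope_gt0; nra.
set u := (1 - 2 * delta) ^+ m.
have u_gt0 : 0 < u.
  rewrite /u; case: (posnP m) => [->|/d2_gt0 ?]; first by rewrite expr0.
  exact: exprn_gt0.
pose A := m.+1%:R * (1 - m%:R * delta).
have A_gt0 : 0 < A by rewrite mulr_gt0 ?ltr0n.
pose Eq := fine 'E_P[horner q \o X].
have W_ge0 j : 0 <= q.[j%:~R] * p j by exact: weight_ge0 dW W_vanishing j.
have mq : measurable_fun [set: R] (horner q).
  by apply: continuous_measurable_fun; exact: continuous_horner.
have EqE := expectation_pmfZ X_int mq W_ge0.
(* The total mass of X^* is 1. *)
have cEq : c * Eq = 1.
  have := expectation_cst P' (1 : R).
  have /(expectation_pmfZ Xs_int (measurable_cst _)) : forall j : int,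
      0 <= cst (1 : R) (j%:~R : R) * pmfZ Xs j.
    by move=> j; rewrite mul1r pmfZ_ge0.
  rewrite /comp /= => -> sum1.
  rewrite /Eq -fineZ EqE -nneseriesZl; last by move=> i _; rewrite lee_fin.
  rewrite -[RHS](congr1 fine sum1); congr fine.
  by apply: eq_eseriesr => i _; rewrite mul1r Xs_pmfE.
have Eq_gt0 : 0 < Eq.
  (* An infinite E[q(X)] would make [Eq] equal to 0, which c * Eq = 1 rules out. *)
  rewrite lt0r; apply/andP; split.
    by apply: contra_eq_neq cEq => ->; rewrite mulr0 eq_sym oner_neq0.
  rewrite /Eq EqE fine_ge0 //; apply: nneseries_ge0 => i _ _.
  by rewrite lee_fin.
have c_gt0 : 0 < c by rewrite -(pmulr_lgt0 _ Eq_gt0) cEq.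
have cE : c = Eq^-1 by rewrite -[RHS]mul1r -cEq mulfK ?gt_eqF.
(* Since p^* = c q p, one factor q joins q^{[m]}(.+1) to form q^{[m+1]}; u collects the denominators
   of q^*. *)
have EsE : fine 'E_P'[ascending (q_star delta (horner q)) m \o Xs]
    = u^-1 * c * fine 'E_P[ascending (horner q) m.+1 \o X].
  have termE j : ascending (q_star delta (horner q)) m j%:~R * pmfZ Xs j
      = u^-1 * c * (ascending (horner q) m.+1 j%:~R * p j).
    rewrite ascending_q_star -/u Xs_pmfE ascendingS -/p.
    rewrite (@eq_ascending _ (fun y => q.[y + 1]) (horner (pshift q)));
      last by move=> y; rewrite pshiftE.
    ring.
  have uc_ge0 : 0 <= u^-1 * c by rewrite mulr_ge0 ?invr_ge0 ?ltW.
  rewrite expectation_pmfZ //; first last.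
  - by move=> j; rewrite termE mulr_ge0.
  - have -> : ascending (q_star delta (horner q)) m
        = (fun x => u^-1 * ascending (horner (pshift q)) m x).
      by apply/funext => x; rewrite ascending_q_star.
    by apply: measurable_funM => //; exact: measurable_ascending.
  rewrite (expectation_pmfZ X_int (measurable_ascending _ _) (asc_ge0 _)).
  rewrite -fineZ -nneseriesZl; last by move=> i _; rewrite lee_fin.
  by congr fine; apply: eq_eseriesr => i _; rewrite termE.
have scaling : (Num.sqrt (m.+1`!%:R * lead_c m.+1 delta
      * fine 'E_P[ascending (horner q) m.+1 \o X]))^-1 * A
    = v_coef X (horner q) delta m * ((Num.sqrt (m`!%:R
      * lead_c m (delta_star delta)
      * fine 'E_P'[ascending (q_star delta (horner q)) m \o Xs]))^-1 * u^-1).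
  rewrite /v_coef -/Eq -/A -(sqrt_scaling _ A_gt0 Eq_gt0 u_gt0).
  congr ((Num.sqrt _)^-1 * A).
  rewrite EsE cE lead_cS; last by move=> /d2_gt0 /lt0r_neq0.
  rewrite factS natrM -/u /A; field.
  by rewrite !gt_eqF.
set N := Num.sqrt _ in scaling; set Ns := Num.sqrt _ in scaling.
set v := v_coef _ _ _ _ in scaling *.
pose F := (N^-1 * (-1) ^+ m.+1) *: rodrigues_poly s q m.+1.
pose G := (Ns^-1 * ((-1) ^+ m * u^-1)) *: rodrigues_poly s (pshift q) m.
have pearson j : q.[j%:~R] * p j = s.[(j + 1)%:~R] * p (j + 1).
  have -> : q.[j%:~R] * p j
      = q.[(j + 1)%:~R] * p (j + 1) - (mu - (j + 1)%:~R) * p (j + 1).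
    by rewrite -dW addrK subKr.
  by rewrite /s hornerD hornerXsubC; ring.
have FE j : supportZ X j -> F.[j%:~R] = std_Rodrigues X (horner q) delta m.+1 j.
  move=> pj; rewrite /std_Rodrigues -/N /Rodrigues.
  rewrite (iter_Delta_rodrigues _ _ pearson).
  rewrite /F hornerZ -/p !mulrA; congr (_ * _); rewrite mulfVK //.
  by rewrite gt_eqF.
have GE j : supportZ Xs j -> G.[j%:~R]
    = std_Rodrigues Xs (q_star delta (horner q)) (delta_star delta) m j.
  move=> pj; rewrite /std_Rodrigues -/Ns /Rodrigues.
  (* The weight p^* = c q p satisfies the same relation with q(.+1) and the same s. *)
  have psearson i : (pshift q).[i%:~R] * pmfZ Xs i
      = s.[(i + 1)%:~R] * pmfZ Xs (i + 1).
    by rewrite !Xs_pmfE pshiftE -/p pearson intrD; ring.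
  rewrite (eq_iter_Delta _ _ (g := fun i => u^-1 *
    (ascending (horner (pshift q)) m (i - m%:Z)%:~R * pmfZ Xs (i - m%:Z)))).
    rewrite iter_DeltaZ (iter_Delta_rodrigues _ _ psearson) /G hornerZ -!mulrA.
    congr (_ * (_ * _)); rewrite [RHS]mulrCA; congr (_ * _).
    by rewrite mulKf // gt_eqF.
  by move=> i; rewrite ascending_q_star mulrA.
have FG : F \Po ('X + 1%:P) - F = v *: G.
  rewrite -[F \Po _]/(pshift F) /F /pshift comp_polyZ -scalerBr.
  rewrite -[rodrigues_poly _ _ _ \Po _]/(pshift _).
  (* The slope of s - q = X - mu is 1 and the second difference of q is 2 delta, so the coefficient
     is -A. *)
  rewrite (@pshift_sub_rodrigues_poly _ _ _ 1 delta); first last.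
  - exact: second_difference_quadratic_poly.
  - rewrite /s (addrC q) addrK /pshift comp_polyB comp_polyX comp_polyC.
    by ring.
  rewrite !scalerA; congr (_ *: _).
  transitivity ((-1) ^+ m * (N^-1 * A)); first by rewrite exprS /A; ring.
  by rewrite scaling; ring.
(* Strict positivity of q p at j uses both j and j + 1 in the support, so [GE] applies at j. *)
have Xs_gt0 j : supportZ X j -> supportZ X (j + 1) -> supportZ Xs j.
  move=> pj pj1; rewrite /supportZ /= Xs_pmfE mulr_gt0 //.
  by apply: (weight_gt0 p_ge0 dW W_vanishing pj pj1); rewrite ?lexx ?ltrDl.
split; last first.
  exists F, G; split=> //; split=> //.
  - rewrite (leq_trans (size_scale_leq _ _)) // size_rodrigues_poly //.
      exact: size_quadratic_poly.
    by rewrite /s opprD addNKr size_polyN size_XsubC.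
  - rewrite (leq_trans (size_scale_leq _ _)) // size_rodrigues_poly //.
      by rewrite size_pshift size_quadratic_poly.
    rewrite /s opprD addrA (leq_trans (size_polyD _ _)) // geq_max.
    by rewrite size_sub_pshift ?size_quadratic_poly // size_polyN size_XsubC.
move=> j pj pj1; rewrite /Delta -!FE // -GE; last exact: Xs_gt0.
by rewrite -hornerZ -FG hornerD hornerN -/(pshift F) pshiftE intrD.
Qed.
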